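(* Let $(X_n)$ be a sequence of Banach spaces which all have the Gaussian average property $\mathrm{GAP}$ with uniformly bounded constants. Then $X=\left(\sum_{n=1}^\infty X_n\right)_2$ has $\mathrm{GAP}$.
   Context: $\pi_1$ denotes the 1-summing norm. For a Banach space $Z$, $\ell_2\otimes Z$ is identified with the finite rank operators from $\ell_2$ to $Z$. $(g_n)$ is a sequence of independent standard Gaussian variables on a probability space $(\Omega,\mathcal{S},\mu)$ and $(e_n)$ is the unit vector basis of $\ell_2$. For $T\in \ell_2\otimes Z$ the $\ell$-norm is $\ell(T)=\left(\int\|\sum_{n=1}^\infty g_n(t)Te_n\|^2d\mu(t)\right)^{1/2}$ (the series converges in $L_2(\mu,Z)$). $Z$ has $\mathrm{GAP}$ (with constant $K$) if $\ell(T)\le K\pi_1(T^* )$ for all $T\in\ell_2\otimes Z$, for some constant $K$. $\left(\sum_{n=1}^\infty X_n\right)_2$ is the $\ell_2$-sum: sequences $(x_n)$ with $x_n\in X_n$ and norm $(\sum\|x_n\|^2)^{1/2}<\infty$. *)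

(* Defs.v *)
From HB Require Import structures.
From mathcomp Require Import all_boot all_order all_algebra.
From mathcomp Require Import ring.
From mathcomp Require Import all_classical all_reals all_analysis.

Set Implicit Arguments.
Unset Strict Implicit.
Unset Printing Implicit Defensive.

Import Order.TTheory GRing.Theory Num.Theory.
Import numFieldNormedType.Exports.

Local Open Scope classical_set_scope.
Local Open Scope ring_scope.

Section square_summable_lemmas.
Context {R : realType}.
Implicit Types a b : nat -> R.

Lemma series_ge0_bounded a (C : R) : (forall k, 0 <= a k) ->
  (forall N, series a N <= C) -> cvgn (series a) /\ limn (series a) <= C.
Proof.
move=> a0 aC.
have ca : cvgn (series a).
  apply: nondecreasing_is_cvgn; first exact: nondecreasing_series.
  by exists C => _ [N _ <-].
by split=> //; apply: limr_le => //; apply: nearW.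
Qed.

Lemma series_le_limn a N : (forall k, 0 <= a k) -> cvgn (series a) ->
  series a N <= limn (series a).
Proof.
move=> a0 ca; apply: (nondecreasing_cvgn_le _ ca).
exact: nondecreasing_series.
Qed.

Lemma minkowski2_aux a b (A B : R) N : 0 <= A -> 0 <= B ->
  (forall k, 0 <= a k) -> (forall k, 0 <= b k) ->
  series (fun k => a k ^+ 2) N <= A ^+ 2 ->
  series (fun k => b k ^+ 2) N <= B ^+ 2 ->
  series (fun k => (a k + b k) ^+ 2) N <= (A + B) ^+ 2.
Proof.
move=> A0 B0 a0 b0 aA bB.
have e_bound e : 0 < e ->
    series (fun k => (a k + b k) ^+ 2) N <= (A + B + (e + e)) ^+ 2.
  move=> e0; set A' := A + e; set B' := B + e.
  have A'0 : 0 < A' by rewrite ltr_wpDl.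
  have B'0 : 0 < B' by rewrite ltr_wpDl.
  have S0 : 0 < A' + B' by rewrite addr_gt0.
  have step k : (a k + b k) ^+ 2 <=
      (A' + B') * (A'^-1 * a k ^+ 2 + B'^-1 * b k ^+ 2).
    rewrite -subr_ge0.
    have -> : (A' + B') * (A'^-1 * a k ^+ 2 + B'^-1 * b k ^+ 2)
        - (a k + b k) ^+ 2 = (B' * a k - A' * b k) ^+ 2 / (A' * B').
      by field; rewrite !gt_eqF.
    by rewrite divr_ge0// ?sqr_ge0// mulr_ge0// ltW.
  have -> : A + B + (e + e) = A' + B' by rewrite /A' /B'; ring.
  apply: (@le_trans _ _ ((A' + B') * (A'^-1 * A' ^+ 2 + B'^-1 * B' ^+ 2))).
    apply: (@le_trans _ _ (\sum_(0 <= k < N)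
        (A' + B') * (A'^-1 * a k ^+ 2 + B'^-1 * b k ^+ 2))).
      by rewrite /series /=; apply: ler_sum => k _; exact: step.
    rewrite -mulr_sumr big_split/= -!mulr_sumr ler_pM2l//.
    apply: lerD; rewrite ler_pM2l ?invr_gt0//.
      by apply: (le_trans aA); rewrite ler_sqr ?nnegrE ?(ltW A'0)// lerDl ltW.
    by apply: (le_trans bB); rewrite ler_sqr ?nnegrE ?(ltW B'0)// lerDl ltW.
  by rewrite !expr2 !mulrA !mulVf ?gt_eqF// !mul1r.
have S0 : 0 <= series (fun k => (a k + b k) ^+ 2) N.
  by apply: sumr_ge0 => k _; exact: sqr_ge0.
rewrite -(sqr_sqrtr S0) ler_sqr ?nnegrE ?sqrtr_ge0 ?addr_ge0//.
apply/ler_addgt0Pr => e e0.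
have e20 : 0 < e / 2 by rewrite divr_gt0.
have := e_bound _ e20; rewrite -splitr => h.
rewrite -ler_sqr ?nnegrE ?sqrtr_ge0 ?addr_ge0 ?(ltW e0)//.
by rewrite sqr_sqrtr.
Qed.

End square_summable_lemmas.

Section ell2_sum_def.
Context {R : realType} (X : nat -> completeNormedModType R).

Definition square_summable (x : forall n, X n) :=
  cvgn (series (fun n => `|x n| ^+ 2)).

Record ell2_sum := Ell2Sum {
  ell2_coord :> forall n, X n ;
  ell2_coordP : square_summable ell2_coord }.
Arguments ell2_coordP : clear implicits.

Lemma ell2_sumP (x y : ell2_sum) : (forall n, x n = y n) -> x = y.
Proof.
case: x y => [x hx] [y hy] /= xy.
have exy : x = y by exact: functional_extensionality_dep.
by case: _ / exy hy => hy; congr Ell2Sum; exact: Prop_irrelevance.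
Qed.

Definition ell2_norm (x : ell2_sum) : R :=
  Num.sqrt (limn (series (fun n => `|x n| ^+ 2))).

Lemma ell2_norm_ge0 x : 0 <= ell2_norm x.
Proof. exact: sqrtr_ge0. Qed.

Lemma ell2_limn_ge0 (x : ell2_sum) : 0 <= limn (series (fun n => `|x n| ^+ 2)).
Proof.
have := series_le_limn 0 (fun k => sqr_ge0 `|x k|) (ell2_coordP x).
by rewrite {1}/series /= big_geq.
Qed.

Lemma ell2_series_le (x : ell2_sum) N :
  series (fun n => `|x n| ^+ 2) N <= ell2_norm x ^+ 2.
Proof.
rewrite /ell2_norm sqr_sqrtr ?ell2_limn_ge0//.
exact: (series_le_limn N (fun k => sqr_ge0 `|x k|) (ell2_coordP x)).
Qed.

Lemma square_summable_bounded (x : forall n, X n) (C : R) :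
  (forall N, series (fun n => `|x n| ^+ 2) N <= C) -> square_summable x.
Proof. by move=> xC; case: (series_ge0_bounded (fun k => sqr_ge0 `|x k|) xC). Qed.

Lemma ell2_norm_le (x : ell2_sum) (C : R) : 0 <= C ->
  (forall N, series (fun n => `|x n| ^+ 2) N <= C ^+ 2) -> ell2_norm x <= C.
Proof.
move=> C0 xC; rewrite -ler_sqr ?nnegrE ?ell2_norm_ge0//.
rewrite /ell2_norm sqr_sqrtr ?ell2_limn_ge0//.
by case: (series_ge0_bounded (fun k => sqr_ge0 `|x k|) xC).
Qed.

Lemma ell2_coord_le (x : ell2_sum) n : `|x n| <= ell2_norm x.
Proof.
rewrite -ler_sqr ?nnegrE ?ell2_norm_ge0//; apply: le_trans (ell2_series_le x n.+1).
by rewrite seriesSr /= lerDr; apply: sumr_ge0.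
Qed.

Lemma ell2_add_series_le (x y : ell2_sum) N :
  series (fun n => `|x n + y n| ^+ 2) N <= (ell2_norm x + ell2_norm y) ^+ 2.
Proof.
apply: le_trans (minkowski2_aux (ell2_norm_ge0 x) (ell2_norm_ge0 y) _ _
  (ell2_series_le x N) (ell2_series_le y N)) => //.
rewrite /series /=; apply: ler_sum => k _.
by rewrite ler_sqr ?nnegrE// ?addr_ge0// ler_normD.
Qed.

Lemma ell2_scale_series (l : R) (x : ell2_sum) N :
  series (fun n => `|l *: x n| ^+ 2) N =
  `|l| ^+ 2 * series (fun n => `|x n| ^+ 2) N.
Proof.
by rewrite /series /= mulr_sumr; apply: eq_bigr => k _; rewrite normrZ exprMn.
Qed.

Lemma ell2_zero_subproof : square_summable (fun n => 0 : X n).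
Proof.
apply: (@square_summable_bounded _ 0) => N.
by rewrite /series /= big1// => k _; rewrite normr0 expr0n.
Qed.

Lemma ell2_add_subproof (x y : ell2_sum) : square_summable (fun n => x n + y n).
Proof. exact: square_summable_bounded (ell2_add_series_le x y). Qed.

Lemma ell2_scale_subproof (l : R) (x : ell2_sum) :
  square_summable (fun n => l *: x n).
Proof.
apply: (@square_summable_bounded _ (`|l| ^+ 2 * ell2_norm x ^+ 2)) => N.
by rewrite ell2_scale_series ler_wpM2l// ?sqr_ge0// ell2_series_le.
Qed.

Lemma ell2_opp_subproof (x : ell2_sum) : square_summable (fun n => - x n).
Proof.
apply: (@square_summable_bounded _ (ell2_norm x ^+ 2)) => N.
apply: le_trans (ell2_series_le x N).
by rewrite /series /=; apply: ler_sum => k _; rewrite normrN.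
Qed.

Definition ell2_zero := Ell2Sum (@ell2_zero_subproof).
Definition ell2_add x y := Ell2Sum (@ell2_add_subproof x y).
Definition ell2_opp x := Ell2Sum (@ell2_opp_subproof x).
Definition ell2_scale l x := Ell2Sum (@ell2_scale_subproof l x).

HB.instance Definition _ := gen_eqMixin ell2_sum.
HB.instance Definition _ := gen_choiceMixin ell2_sum.

Fact ell2_addA : associative ell2_add.
Proof. by move=> x y z; apply: ell2_sumP => n /=; rewrite addrA. Qed.
Fact ell2_addC : commutative ell2_add.
Proof. by move=> x y; apply: ell2_sumP => n /=; rewrite addrC. Qed.
Fact ell2_add0 : left_id ell2_zero ell2_add.
Proof. by move=> x; apply: ell2_sumP => n /=; rewrite add0r. Qed.
Fact ell2_addN : left_inverse ell2_zero ell2_opp ell2_add.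
Proof. by move=> x; apply: ell2_sumP => n /=; rewrite addNr. Qed.

HB.instance Definition _ :=
  GRing.isZmodule.Build ell2_sum ell2_addA ell2_addC ell2_add0 ell2_addN.

Fact ell2_scaleA a b (x : ell2_sum) :
  ell2_scale a (ell2_scale b x) = ell2_scale (a * b) x.
Proof. by apply: ell2_sumP => n /=; rewrite scalerA. Qed.
Fact ell2_scale1 : left_id 1 ell2_scale.
Proof. by move=> x; apply: ell2_sumP => n /=; rewrite scale1r. Qed.
Fact ell2_scaleDr : right_distributive ell2_scale +%R.
Proof. by move=> a x y; apply: ell2_sumP => n /=; rewrite scalerDr. Qed.
Fact ell2_scaleDl (x : ell2_sum) : {morph ell2_scale^~ x : a b / a + b}.
Proof. by move=> a b; apply: ell2_sumP => n /=; rewrite scalerDl. Qed.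

HB.instance Definition _ := GRing.Zmodule_isLmodule.Build R ell2_sum
  ell2_scaleA ell2_scale1 ell2_scaleDr ell2_scaleDl.

Fact ell2_normD (x y : ell2_sum) : ell2_norm (x + y) <= ell2_norm x + ell2_norm y.
Proof.
apply: ell2_norm_le; first by rewrite addr_ge0// ell2_norm_ge0.
exact: ell2_add_series_le.
Qed.

Fact ell2_normZ l (x : ell2_sum) : ell2_norm (l *: x) = `|l| * ell2_norm x.
Proof.
have le_normZ k (y : ell2_sum) : ell2_norm (k *: y) <= `|k| * ell2_norm y.
  apply: ell2_norm_le => [|N]; first by rewrite mulr_ge0// ell2_norm_ge0.
  rewrite [leLHS]ell2_scale_series exprMn.
  by rewrite ler_wpM2l// ?sqr_ge0// ell2_series_le.
apply/eqP; rewrite eq_le le_normZ/=.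
have [->|l0] := eqVneq l 0; first by rewrite normr0 mul0r ell2_norm_ge0.
rewrite -ler_pdivlMl ?normr_gt0// -normfV.
by apply: le_trans (le_normZ _ _); rewrite scalerA mulVf// scale1r.
Qed.

Fact ell2_norm0_eq0 (x : ell2_sum) : ell2_norm x = 0 -> x = 0.
Proof.
move=> x0; apply: ell2_sumP => n; apply/eqP; rewrite -normr_le0 -x0.
exact: ell2_coord_le.
Qed.

HB.instance Definition _ := Lmodule_isNormed.Build R ell2_sum
  ell2_normD ell2_normZ ell2_norm0_eq0.

Lemma ell2_normE (x : ell2_sum) : `|x| = ell2_norm x.
Proof. by []. Qed.

Fact ell2_sum_complete (F : set_system ell2_sum) :
  ProperFilter F -> cauchy F -> cvg F.
Proof.
move=> FF /cauchy_ballP Fc.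
have coordF n : cvg ((fun x : ell2_sum => x n) @ F).
  apply/cauchy_cvgP/cauchy_ballP => e e0.
  rewrite near_map2; apply: filterS (Fc _ e0) => -[x y].
  rewrite /= -!ball_normE /=; apply: le_lt_trans.
  by have := ell2_coord_le (x - y) n.
pose y n := lim ((fun x : ell2_sum => x n) @ F).
have near_y (x0 : ell2_sum) e : 0 < e -> F (ball x0 e) -> forall N,
    series (fun n => `|x0 n - y n| ^+ 2) N <= e ^+ 2.
  move=> e0 Fx0 N.
  have cy : (fun x : ell2_sum => series (fun n => `|x0 n - x n| ^+ 2) N) @ F
      --> series (fun n => `|x0 n - y n| ^+ 2) N.
    rewrite /series /=; apply: cvg_big => // [|n _].
      by move=> ? ?; exact: add_continuous.
    have cn : (fun x : ell2_sum => `|x0 n - x n|) @ F --> `|x0 n - y n|.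
      by apply: cvg_norm; apply: cvgB; [exact: cvg_cst|exact: coordF].
    exact: (cvgM cn cn).
  rewrite -(cvg_lim _ cy)//; apply: limr_le; first by apply/cvg_ex; exists (series (fun n => `|x0 n - y n| ^+ 2) N).
  apply: filterS Fx0 => x.
  rewrite -ball_normE /= => x0x; apply: le_trans (ell2_series_le (x0 - x) N) _.
  by rewrite ler_sqr ?nnegrE ?ell2_norm_ge0 ?ltW.
have [x1 Fx1] : exists x1, F (ball x1 1).
  by have /cauchy_ballP/cauchyP/(_ 1 ltr01)[x1] := Fc; exists x1.
have sub_summable : square_summable (fun n => x1 n - y n).
  exact: square_summable_bounded (near_y _ _ ltr01 Fx1).
have [z zE] : exists z : ell2_sum, forall n, z n = y n.
  exists (x1 - Ell2Sum sub_summable) => n /=.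
  by rewrite opprB addrC subrK.
apply/cvg_ex; exists z; apply/cvgrPdist_le => e e0.
have e20 : 0 < e / 2 by rewrite divr_gt0.
have [x2 Fx2] : exists x2, F (ball x2 (e / 2)).
  by have /cauchy_ballP/cauchyP/(_ _ e20)[x2] := Fc; exists x2.
have zx2 : `|x2 - z| <= e / 2.
  apply: ell2_norm_le => [|N]; first exact: ltW.
  have := near_y _ _ e20 Fx2 N; apply: le_trans.
  by rewrite /series /=; apply: ler_sum => k _; rewrite -zE.
apply: filterS Fx2 => x; rewrite -ball_normE /= => x2x.
rewrite (splitr e); apply: le_trans (ler_distD x2 _ _) _.
by rewrite lerD// ?(ltW x2x)// distrC.
Qed.

HB.instance Definition _ := Uniform_isComplete.Build ell2_sum ell2_sum_complete.

End ell2_sum_def.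

Definition ell2 (R : realType) : completeNormedModType R :=
  ell2_sum (fun _ : nat => R^o).

Section ell2_basis.
Context {R : realType} (n : nat).

Fact ell2_unit_subproof : @square_summable R (fun _ => R^o) (fun k => (k == n)%:R).
Proof.
apply: (@square_summable_bounded _ _ _ 1) => N.
have -> : series (fun k => `|(k == n)%:R : R^o| ^+ 2) N = (n < N)%:R.
  elim: N => [|N IHN]; first by rewrite /series /= big_geq.
  rewrite seriesSr /= IHN ltnS.
  by case: ltngtP => _ /=; rewrite ?normr0 ?normr1 ?expr0n ?expr1n ?addr0 ?add0r.
by case: ltnP.
Qed.

Definition ell2_unit : ell2 R := Ell2Sum (@ell2_unit_subproof).

End ell2_basis.

Section bounded_operators.
Context {R : realType} (E F : normedModType R).

Definition bounded_op_pred : {pred E -> F} :=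
  mem [set f : E -> F | linear f /\ continuous f].

Record bounded_op := BoundedOp {
  bounded_op_fun :> E -> F ;
  bounded_opP : bounded_op_fun \in bounded_op_pred }.

HB.instance Definition _ := [isSub for bounded_op_fun].
HB.instance Definition _ := [Choice of bounded_op by <:].

Fact bounded_op_submod_closed : submod_closed bounded_op_pred.
Proof.
split=> [|a f g].
  rewrite inE; split=> [a x y|x]; last exact: cvg_cst.
  by change (0 = a *: 0 + 0 :> F); rewrite scaler0 addr0.
rewrite !inE => -[fl fc] [gl gc]; split=> [b x y|x].
  change (a *: f (b *: x + y) + g (b *: x + y) =
          b *: (a *: f x + g x) + (a *: f y + g y)).
  by rewrite fl gl !scalerDr !scalerA (mulrC a b) addrACA.
by apply: cvgD; [apply: cvgZr; exact: fc|exact: gc].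
Qed.

HB.instance Definition _ :=
  GRing.isSubmodClosed.Build R (E -> F) bounded_op_pred bounded_op_submod_closed.
HB.instance Definition _ := [SubChoice_isSubLmodule of bounded_op by <:].

Fact bounded_op_linear (T : bounded_op) : linear T.
Proof. by have := bounded_opP T; rewrite inE => -[]. Qed.

HB.instance Definition _ (T : bounded_op) :=
  GRing.isLinear.Build R E F *:%R T (bounded_op_linear T).

Fact bounded_op_continuous (T : bounded_op) : continuous T.
Proof. by have := bounded_opP T; rewrite inE => -[]. Qed.

Definition op_norm (T : bounded_op) : R :=
  sup [set `|T x| | x in [set x : E | `|x| <= 1]].

Lemma op_norm_has_sup (T : bounded_op) :
  has_sup [set `|T x| | x in [set x : E | `|x| <= 1]].
Proof.
split; first by exists `|T 0|; exists 0 => //=; rewrite normr0.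
have /linear_bounded_continuous/linear_boundedP Tb := @bounded_op_continuous T.
have [r [r0 Tr]] : exists r, 0 < r /\ forall x, `|T x| <= r * `|x|.
  have [r r0 Tr] := pinfty_ex_gt0 Tb; by exists r.
exists r => _ [x x1 <-]; apply: le_trans (Tr x) _.
by rewrite ler_piMr// ltW.
Qed.

Lemma op_norm_ub (T : bounded_op) x : `|x| <= 1 -> `|T x| <= op_norm T.
Proof. by move=> x1; apply: ub_le_sup; [case: (op_norm_has_sup T)|exists x]. Qed.

Lemma op_norm_ge0 (T : bounded_op) : 0 <= op_norm T.
Proof. by apply: le_trans (op_norm_ub T (x := 0) _); rewrite ?normr0. Qed.

Lemma op_norm_le (T : bounded_op) (C : R) :
  (forall x, `|x| <= 1 -> `|T x| <= C) -> op_norm T <= C.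
Proof.
move=> TC; apply: ge_sup; first by case: (op_norm_has_sup T).
by move=> _ [x x1 <-]; exact: TC.
Qed.

Lemma op_normP (T : bounded_op) x : `|T x| <= op_norm T * `|x|.
Proof.
have [->|x0] := eqVneq x 0; first by rewrite linear0 !normr0 mulr0.
have nx0 : 0 < `|x| by rewrite normr_gt0.
rewrite -ler_pdivrMr// mulrC -[X in X * _]gtr0_norm ?invr_gt0// -normrZ -linearZ.
by apply: op_norm_ub; rewrite normrZ gtr0_norm ?invr_gt0// mulVf// gt_eqF.
Qed.

Fact op_normD (S T : bounded_op) : op_norm (S + T) <= op_norm S + op_norm T.
Proof.
apply: op_norm_le => x x1; apply: le_trans (ler_normD _ _) _.
by rewrite lerD// op_norm_ub.
Qed.

Fact op_normZ l (T : bounded_op) : op_norm (l *: T) = `|l| * op_norm T.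
Proof.
have le_normZ k (S : bounded_op) : op_norm (k *: S) <= `|k| * op_norm S.
  apply: op_norm_le => x x1; rewrite [leLHS]normrZ.
  by rewrite ler_wpM2l// op_norm_ub.
apply/eqP; rewrite eq_le le_normZ/=.
have [->|l0] := eqVneq l 0; first by rewrite normr0 mul0r op_norm_ge0.
rewrite -ler_pdivlMl ?normr_gt0// -normfV.
by apply: le_trans (le_normZ _ _); rewrite scalerA mulVf// scale1r.
Qed.

Fact op_norm0_eq0 (T : bounded_op) : op_norm T = 0 -> T = 0.
Proof.
move=> T0; apply: val_inj; apply/funext => x; apply/eqP.
by rewrite -normr_le0; apply: le_trans (op_normP T x) _; rewrite T0 mul0r.
Qed.

HB.instance Definition _ := Lmodule_isNormed.Build R bounded_op
  op_normD op_normZ op_norm0_eq0.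

Definition finite_rank (T : bounded_op) :=
  exists m (z : 'I_m -> F), forall x, exists c : 'I_m -> R,
    T x = \sum_(i < m) c i *: z i.

End bounded_operators.

(* Pietsch's definition of the 1-summing norm is in terms of the dual ball, so
   the dual carries the operator norm; the adjoint of [T : ell2 -> Z] lands in
   the dual of [ell2], isometric to [ell2]. *)
Definition dual {R : realType} (E : normedModType R) : normedModType R :=
  bounded_op E R^o.

Section adjoint.
Context {R : realType} {E F : normedModType R} (T : bounded_op E F).

Fact adjoint_fun_subproof (f : dual F) : f \o T \in @bounded_op_pred R E R^o.
Proof.
rewrite inE; split=> [a x y|x] /=; first by rewrite !linearP.
by apply: continuous_comp; exact: bounded_op_continuous.
Qed.

Definition adjoint_fun (f : dual F) : dual E :=
  BoundedOp (adjoint_fun_subproof f).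

Fact adjoint_subproof : adjoint_fun \in @bounded_op_pred R (dual F) (dual E).
Proof.
have al : linear adjoint_fun by move=> a f g; exact: val_inj.
rewrite inE; split => //.
pose L : {linear dual F -> dual E} :=
  HB.pack adjoint_fun (GRing.isLinear.Build _ _ _ _ _ al).
apply: (@bounded_linear_continuous _ _ _ L); apply/linear_boundedP.
near=> r => f; apply: op_norm_le => x x1 /=.
apply: le_trans (op_normP f (T x)) _; rewrite mulrC ler_wpM2r ?op_norm_ge0//.
apply: le_trans (op_norm_ub T x1) _.
by near: r; apply: nbhs_pinfty_ge; rewrite num_real.
Unshelve. all: by end_near. Qed.

Definition adjoint : bounded_op (dual F) (dual E) := BoundedOp adjoint_subproof.

End adjoint.

(* The value is [+oo] when no constant [C] works, i.e. when [S] is not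
   1-summing. *)
Definition pi1 {R : realType} {E F : normedModType R} (S : bounded_op E F)
    : \bar R :=
  ereal_inf [set C%:E | C in [set C : R | 0 <= C /\
    forall (m : nat) (x : 'I_m -> E),
      \sum_(i < m) `|S (x i)| <=
      C * sup [set \sum_(i < m) `|phi (x i)| |
               phi in [set phi : dual E | `|phi| <= 1]]]].

Section gaussian_sequence.
Context {d : measure_display} {Omega : measurableType d} {R : realType}.
Variables (mu : probability Omega R) (g : nat -> {RV mu >-> R}).

Definition independent_sequence := forall (s : seq nat) (A : nat -> set R),
  uniq s -> (forall n, measurable (A n)) ->
  mu (\bigcap_(n in [set` s]) (g n @^-1` A n)) =
  (\prod_(n <- s) mu (g n @^-1` A n))%E.

Definition standard_gaussian (h : {RV mu >-> R}) :=
  forall A : set R, measurable A -> distribution mu h A = normal_prob 0 1 A.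

Definition gaussian_sequence :=
  independent_sequence /\ forall n, standard_gaussian (g n).

Section ell_norm.
Context {Z : normedModType R}.

Definition strongly_measurable (f : Omega -> Z) :=
  exists s : nat -> Omega -> Z,
    (forall k, finite_set (range (s k)) /\
       forall z, measurable (s k @^-1` [set z])) /\
    (forall t, s ^~ t @ \oo --> f t).

Definition is_L2_limit (u : nat -> Omega -> Z) (f : Omega -> Z) :=
  strongly_measurable f /\
  (\int[mu]_t (`|f t - u N t| ^+ 2)%:E)%E @[N --> \oo] --> 0%E.

Definition gaussian_partial_sum (T : bounded_op (ell2 R) Z) (N : nat)
    (t : Omega) : Z := \sum_(n < N) g n t *: T (ell2_unit n).

(* The sum of the series in L_2(mu, Z). For a Gaussian sequence [g] and [T] of
   finite rank the limit exists and is unique up to a null set, so the default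
   value of [xget] is never reached and [ell_norm] does not depend on the
   representative chosen. *)
Definition gaussian_sum (T : bounded_op (ell2 R) Z) : Omega -> Z :=
  xget (fun _ => 0) [set f | is_L2_limit (gaussian_partial_sum T) f].

Definition ell_norm (T : bounded_op (ell2 R) Z) : \bar R :=
  ((\int[mu]_t (`|gaussian_sum T t| ^+ 2)%:E) `^ 2^-1)%E.

End ell_norm.

Definition GAP_with (Z : completeNormedModType R) (K : R) :=
  forall T : bounded_op (ell2 R) Z, finite_rank T ->
    (ell_norm T <= K%:E * pi1 (adjoint T))%E.

Definition GAP (Z : completeNormedModType R) := exists K : R, GAP_with Z K.

End gaussian_sequence.

(* Main.v *)
Require Import Defs.
From HB Require Import structures.
From mathcomp Require Import all_boot all_order all_algebra.
From mathcomp Require Import ring.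
From mathcomp Require Import all_classical all_reals all_analysis.
From mathcomp Require Import measurable_realfun.

Set Implicit Arguments.
Unset Strict Implicit.
Unset Printing Implicit Defensive.

Import Order.TTheory GRing.Theory Num.Theory.
Import numFieldNormedType.Exports.

Local Open Scope classical_set_scope.
Local Open Scope ring_scope.

(** Write [T n] for the [n]-th component of [T : ell2 -> X] and [p n] for the
    1-summing norm of its adjoint. The Gaussian sum of [T n] is the [n]-th
    coordinate of that of [T], so that
    [ell(T)^2 = sum_n ell(T n)^2 <= K^2 sum_n (p n)^2], and it remains to bound
    [sum_n (p n)^2] by the square of the 1-summing norm of the adjoint of [T].
    For this, take for each [n] a finite family in the dual of [X n] of weak
    l1-norm at most 1 which nearly attains [p n], multiply it by [p n] and view
    it in the dual of [X]; by Cauchy-Schwarz the union of these families over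
    [n < N] has weak l1-norm at most [(sum_(n < N) (p n)^2)^(1/2)]. *)

(** * Weak l1-norms of families in a dual space and the 1-summing norm *)

Section bounded_operators.
Context {R : realType}.
Implicit Types E F G : normedModType R.

Lemma bounded_op_predI E F (f : E -> F) (C : R) :
  linear f -> (forall x, `|f x| <= C * `|x|) -> f \in @bounded_op_pred R E F.
Proof.
move=> fl fC; rewrite inE; split => //.
pose L : {linear E -> F} := HB.pack f (GRing.isLinear.Build _ _ _ _ _ fl).
apply: (@bounded_linear_continuous _ _ _ L); apply/linear_boundedP.
near=> r => x; apply: le_trans (fC x) _.
apply: ler_wpM2r => //; near: r; apply: nbhs_pinfty_ge; rewrite num_real.
Unshelve. all: by end_near. Qed.

Lemma comp_op_subproof E F G (S : bounded_op F G) (T : bounded_op E F) :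
  S \o T \in @bounded_op_pred R E G.
Proof.
rewrite inE; split=> [a x y|x] /=; first by rewrite !linearP.
by apply: continuous_comp; exact: bounded_op_continuous.
Qed.

Definition comp_op E F G (S : bounded_op F G) (T : bounded_op E F) :=
  BoundedOp (comp_op_subproof S T).

Lemma adjoint_comp_op E F G (S : bounded_op F G) (T : bounded_op E F) y :
  adjoint (comp_op S T) y = adjoint T (adjoint S y).
Proof. exact: val_inj. Qed.

Lemma finite_rank_comp_op E F G (S : bounded_op F G) (T : bounded_op E F) :
  finite_rank T -> finite_rank (comp_op S T).
Proof.
move=> [m [z Tz]]; exists m, (S \o z) => x; have [c Tx] := Tz x; exists c.
by rewrite /= Tx linear_sum; apply: eq_bigr => i _; rewrite linearZ.
Qed.

Lemma evaluation_subproof E (z : E) :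
  (fun y : dual E => y z) \in @bounded_op_pred R (dual E) R^o.
Proof.
by apply: (@bounded_op_predI _ _ _ `|z|) => // y; rewrite mulrC; exact: op_normP.
Qed.

Definition evaluation E (z : E) : dual (dual E) :=
  BoundedOp (evaluation_subproof z).

Lemma evaluation_norm_le1 E (z : E) : `|z| <= 1 -> `|evaluation z| <= 1.
Proof.
move=> z1; apply: op_norm_le => y y1; apply: le_trans (op_normP y z) _.
by apply: mulr_ile1 => //; exact: op_norm_ge0.
Qed.

(** Weak l1-norm at most [B], tested on the unit ball of [E] instead of that of the bidual. A
    general finite index type allows disjoint unions without renumbering. *)
Definition weak_le E (I : finType) (y : I -> dual E) (B : R) :=
  forall z : E, `|z| <= 1 -> \sum_i `|y i z| <= B.

(* By choosing signs, [sum |phi (y i)|] is [phi] of a single functional. *)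
Lemma weak_le_bidual E (I : finType) (y : I -> dual E) (B : R)
    (phi : dual (dual E)) :
  weak_le y B -> `|phi| <= 1 -> \sum_i `|phi (y i)| <= B.
Proof.
move=> yB phi1.
pose w : dual E := \sum_i Num.sg (phi (y i)) *: y i.
have -> : \sum_i `|phi (y i)| = phi w.
  rewrite linear_sum; apply: eq_bigr => i _; rewrite linearZ.
  exact: normrEsg.
apply: le_trans (ler_norm _) _; apply: le_trans (op_normP phi w) _.
apply: (@le_trans _ _ `|w|); first by rewrite ler_piMl.
apply: op_norm_le => z /yB; apply: le_trans.
have -> : w z = \sum_i Num.sg (phi (y i)) * y i z.
  exact: (linear_sum (evaluation z)).
apply: le_trans (ler_norm_sum _ _ _) _; apply: ler_sum => i _.
rewrite normrM normr_sg; case: eqP; rewrite ?mul0r ?mul1r//.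
Qed.

(** The inequality on [C] in [pi1], separated from the condition [0 <= C]. *)
Definition pi1_bound E F (S : bounded_op E F) (C : R) :=
  forall (m : nat) (x : 'I_m -> E),
      \sum_(i < m) `|S (x i)| <=
      C * sup [set \sum_(i < m) `|phi (x i)| |
               phi in [set phi : dual E | `|phi| <= 1]].

(** The supremum over the bidual ball is at most [B] by [weak_le_bidual]; conversely it is itself a
    weak bound, since evaluations at points of the unit ball are among the functionals. *)
Lemma pi1_bound_weak_le E F (S : bounded_op (dual E) F) (C : R) : 0 <= C ->
  pi1_bound S C <->
  (forall (I : finType) (y : I -> dual E) B, weak_le y B ->
    \sum_i `|S (y i)| <= C * B).
Proof.
move=> C0; split=> [SC I y B yB|SC m y].
  have sumE (h : I -> R) : \sum_(k < #|I|) h (enum_val k) = \sum_i h i.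
    by rewrite [RHS](big_enum_val (A := I)).
  have := SC _ (fun k : 'I_#|I| => y (enum_val k)).
  rewrite (sumE (fun i => `|S (y i)|)) => /le_trans; apply.
  apply: ler_wpM2l => //; apply: ge_sup.
    exists (\sum_(k < #|I|) `|(0 : dual (dual E)) (y (enum_val k))|), 0 => //.
    by rewrite /= normr0.
  move=> _ [phi phi1 <-].
  by rewrite (sumE (fun i => `|phi (y i)|)); exact: weak_le_bidual.
apply: SC => z z1; apply: ub_le_sup; last first.
  by exists (evaluation z) => //; exact: evaluation_norm_le1.
(* The supremum must be shown finite, as [sup] has a default value on unbounded sets. *)
exists (\sum_i `|y i|) => _ [phi phi1 <-]; apply: ler_sum => i _.
by apply: le_trans (op_normP phi (y i)) _; rewrite ler_piMl.
Qed.

Lemma pi1_le E F (S : bounded_op E F) (C : R) : 0 <= C -> pi1_bound S C ->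
  (pi1 S <= C%:E)%E.
Proof. by move=> C0 SC; apply: ereal_inf_lbound; exists C. Qed.

Lemma pi1_ge0 E F (S : bounded_op E F) : (0 <= pi1 S)%E.
Proof. by apply: le_ereal_inf_tmp => _ [C [C0 _] <-]; rewrite lee_fin. Qed.

End bounded_operators.

(** * 1-summing norms of the components of an operator into the l2-sum *)

Section ell2_sum_operators.
Context {R : realType} (X : nat -> completeNormedModType R).

Fact ell2_proj_subproof n :
  (fun x : ell2_sum X => x n) \in @bounded_op_pred R (ell2_sum X) (X n).
Proof.
by apply: (@bounded_op_predI _ _ _ _ 1) => // x; rewrite mul1r; exact: ell2_coord_le.
Qed.

Definition ell2_proj n : bounded_op (ell2_sum X) (X n) :=
  BoundedOp (ell2_proj_subproof n).

(** The main estimate. The real number [d n] stands for the 1-summing norm [p n]: it is the supremum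
    of the sums attained on finite families of weak l1-norm at most 1. *)
Lemma pi1_bound_ell2_sum (E : normedModType R) (T : bounded_op E (ell2_sum X))
    (C : R) : 0 <= C -> pi1_bound (adjoint T) C ->
  exists2 d : nat -> R, (forall N, series (fun n => d n ^+ 2) N <= C ^+ 2) &
    forall n, 0 <= d n /\ (pi1 (adjoint (comp_op (ell2_proj n) T)) <= (d n)%:E)%E.
Proof.
move=> C0 /(pi1_bound_weak_le _ C0) TC.
pose S n := adjoint (comp_op (ell2_proj n) T).
pose D n := [set s | exists m (y : 'I_m -> dual (X n)),
  weak_le y 1 /\ s = \sum_i `|S n (y i)|].
have D0 n : D n 0.
  by exists 0%N, (fun=> 0); split=> [z _|]; rewrite big_ord0.
(* Coordinates are contractive, so a family in the dual of [X n] keeps its weak bound when viewed in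
   the dual of the l2-sum. *)
have DC n : ubound (D n) C.
  move=> _ [m [y [y1 ->]]].
  have := TC _ (fun i => adjoint (ell2_proj n) (y i)) 1; rewrite mulr1; apply.
  by move=> z z1; apply: y1; apply: le_trans z1; exact: ell2_coord_le.
have Dsup n : has_sup (D n) by split; [exists 0|exists C].
pose d n := sup (D n).
have d0 n : 0 <= d n by apply: ub_le_sup => //; exact: (Dsup n).2.
exists d; last first.
  move=> n; split => //; apply: pi1_le => //; apply/pi1_bound_weak_le => // I y B yB.
  have B0 : 0 <= B.
    by apply: le_trans (yB 0 _); rewrite ?normr0// sumr_ge0.
  apply/ler_addgt0Pr => e e0.
  have d1 : 0 < d n + 1 by rewrite ltr_wpDl.
  (* Since [B] may be 0, the family is divided by the larger [b], chosen so that
     [d n * b <= d n * B + e]. *)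
  pose b := B + e / (d n + 1).
  have b0 : 0 < b by rewrite ltr_wpDl// divr_gt0.
  suff : \sum_i `|S n (b^-1 *: y i)| <= d n.
    under eq_bigr do rewrite linearZ normrZ gtr0_norm ?invr_gt0//.
    rewrite -mulr_sumr ler_pdivrMl// => /le_trans; apply.
    rewrite /b mulrDl mulrC lerD2l mulrAC ler_pdivrMr// ler_pM2l// lerDl//.
  apply: ub_le_sup; first exact: (Dsup n).2.
  exists #|I|, (fun k => b^-1 *: y (enum_val k)); split.
    move=> z z1.
    under eq_bigr do rewrite normrZ gtr0_norm ?invr_gt0//.
    rewrite -mulr_sumr ler_pdivrMl// mulr1.
    have -> : \sum_(k < #|I|) `|y (enum_val k) z| = \sum_i `|y i z|.
      by rewrite [RHS](big_enum_val (A := I)).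
    by apply: le_trans (yB z z1) _; rewrite lerDl ltW// divr_gt0.
  by rewrite [LHS](big_enum_val (A := I)).
move=> N; rewrite /series /= big_mkord.
set Q := \sum_(n < N) _.
have Q0 : 0 <= Q by apply: sumr_ge0 => n _; exact: sqr_ge0.
pose s := Num.sqrt Q.
have sE : Q = s ^+ 2 by rewrite sqr_sqrtr.
have [s0|s0] := eqVneq s 0; first by rewrite sE s0 expr0n sqr_ge0.
have {s0}s0 : 0 < s by rewrite lt_neqAle eq_sym s0 sqrtr_ge0.
rewrite sE ler_sqr ?nnegrE ?(ltW s0)//.
(* As [Q = s ^+ 2], the goal [s <= C] follows from [Q <= C * s]. The left side of [key] is
   [Q - e * A], with [A] the sum of the [d n]; so [key] at [e / (A + 1)] loses at most [e]. *)
suff key e : 0 < e -> \sum_(n < N) d n * (d n - e) <= C * s.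
  rewrite -(ler_pM2r s0) -expr2 -sE; apply/ler_addgt0Pr => e e0.
  pose A := \sum_(n < N) d n.
  have A0 : 0 <= A by exact: sumr_ge0.
  have A1 : 0 < A + 1 by rewrite ltr_wpDl.
  have e'0 : 0 < e / (A + 1) by rewrite divr_gt0.
  have := key _ e'0; under eq_bigr do rewrite mulrBr -expr2.
  rewrite big_split /= sumrN -mulr_suml -/A -/Q lerBlDr => /le_trans; apply.
  by rewrite lerD2l mulrA ler_pdivrMr// mulrC ler_pM2l// lerDl.
move=> e0.
(* The size of the family depends on [n], so size and family are chosen together as a dependent
   pair. *)
have nearly_optimal (n : 'I_N) : {p : {m & 'I_m -> dual (X n)} |
    weak_le (projT2 p) 1 /\ d n - e < \sum_i `|S n (projT2 p i)|}.
  apply: cid; have [_ [m [y [y1 ->]]] dy] := sup_adherent e0 (Dsup n).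
  by exists (existT _ m y).
pose f n := sval (nearly_optimal n).
have fP n : weak_le (projT2 (f n)) 1 /\ d n - e < \sum_i `|S n (projT2 (f n) i)|.
  exact: svalP (nearly_optimal n).
(* The disjoint union of the families. The weights [d n], divided by [s], form the unit vector that
   norms [d] in l2, so no constant is lost. *)
pose I := {n : 'I_N & 'I_(projT1 (f n))}.
pose y (p : I) : dual (ell2_sum X) :=
  d (tag p) *: adjoint (ell2_proj (tag p)) (projT2 (f (tag p)) (tagged p)).
have sumI (h : forall n : 'I_N, 'I_(projT1 (f n)) -> R) :
    \sum_(p : I) h (tag p) (tagged p) = \sum_n \sum_i h n i.
  by rewrite (sig_big_dep (fun=> true) (fun _ _ => true)).
(* Lower estimate: block [n] contributes [d n] times a sum exceeding [d n - e]. *)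
apply: (@le_trans _ _ (\sum_(p : I) `|adjoint T (y p)|)).
  rewrite (sumI (fun (n : 'I_N) i =>
    `|adjoint T (d n *: adjoint (ell2_proj n) (projT2 (f n) i))|)).
  apply: ler_sum => n _.
  have nS i : `|adjoint T (d n *: adjoint (ell2_proj n) (projT2 (f n) i))| =
      d n * `|S n (projT2 (f n) i)|.
    by rewrite linearZ normrZ ger0_norm// /S adjoint_comp_op.
  under [leRHS]eq_bigr do rewrite nS.
  by rewrite -mulr_sumr; apply: ler_wpM2l => //; apply: ltW; case: (fP n).
(* Upper estimate: the union has weak l1-norm at most [s]. *)
apply: TC => z z1.
rewrite (sumI (fun (n : 'I_N) i =>
  `|(d n *: adjoint (ell2_proj n) (projT2 (f n) i)) z|)).
apply: (@le_trans _ _ (\sum_(n < N) d n * `|z n|)).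
  apply: ler_sum => n _.
  under eq_bigr do rewrite normrZ ger0_norm//.
  rewrite -mulr_sumr ler_wpM2l//=.
  (* The weak bound holds on the unit ball only, so [z n] is normalized, the zero vector being
     treated apart. *)
  have [zn0|zn0] := eqVneq (z n) 0.
    by rewrite zn0 normr0 big1// => i _; rewrite linear0 normr0.
  have nz0 : 0 < `|z n| by rewrite normr_gt0.
  have := (fP n).1 (`|z n|^-1 *: z n).
  rewrite normrZ gtr0_norm ?invr_gt0// mulVf ?gt_eqF// => /(_ (lexx _)).
  have uZ (u : dual (X n)) : `|u (`|z n|^-1 *: z n)| = `|z n|^-1 * `|u (z n)|.
    by rewrite linearZ normrZ gtr0_norm ?invr_gt0.
  rewrite (eq_bigr _ (fun i _ => uZ (projT2 (f n) i))).
  by rewrite -mulr_sumr ler_pdivrMl// mulr1.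
(* Cauchy-Schwarz, through [2 d `|z| <= d^2 / s + s `|z|^2] *)
apply: (@le_trans _ _ (\sum_(n < N) (s^-1 * d n ^+ 2 + s * `|z n| ^+ 2) / 2)).
  apply: ler_sum => n _; rewrite -subr_ge0.
  have -> : (s^-1 * d n ^+ 2 + s * `|z n| ^+ 2) / 2 - d n * `|z n| =
            (d n - s * `|z n|) ^+ 2 / (2 * s) by field; rewrite gt_eqF.
  by rewrite divr_ge0 ?sqr_ge0// mulr_ge0// ltW.
rewrite -mulr_suml big_split /= -!mulr_sumr -/Q sE expr2 mulKf ?gt_eqF//.
rewrite ler_pdivrMr// mulr_natr mulr2n lerD2l ler_piMr ?(ltW s0)//.
have := ell2_series_le z N; rewrite /series /= big_mkord => /le_trans; apply.
by rewrite expr_le1// ell2_norm_ge0.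
Qed.

End ell2_sum_operators.

(** * Strong measurability and limits in L2 of vector-valued functions *)

Section strong_measurability.
Import HBSimple.
Context {R : realType} {d : measure_display} {Omega : measurableType d}.
Implicit Types Z : normedModType R.

(** The condition on the approximants in [strongly_measurable]. It concerns fibres, so the codomain
    carries no sigma-algebra. *)
Definition simple_fun (A : Type) (s : Omega -> A) :=
  finite_set (range s) /\ forall a, measurable (s @^-1` [set a]).

Lemma simple_fun_preimage (A : Type) (s : Omega -> A) (Y : set A) :
  simple_fun s -> measurable (s @^-1` Y).
Proof.
move=> [sfin sm].
have -> : s @^-1` Y = \bigcup_(a in range s `&` Y) (s @^-1` [set a]).
  apply/seteqP; split=> [t Yt|t [a [_ Ya] /= ->]] //.
  by exists (s t) => //; split => //; exists t.
by apply: fin_bigcup_measurable => [|a _]; [exact: finite_setIl|exact: sm].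
Qed.

Lemma simple_fun_comp2 (A B C : Type) (h : A -> B -> C)
    (s : Omega -> A) (s' : Omega -> B) :
  simple_fun s -> simple_fun s' -> simple_fun (fun t => h (s t) (s' t)).
Proof.
move=> ss ss'; split.
  apply: sub_finite_set (finite_image2 h ss.1 ss'.1) => _ [t _ <-].
  by exists (s t); [exists t|exists (s' t) => //; exists t].
move=> c.
have -> : (fun t => h (s t) (s' t)) @^-1` [set c] =
    \bigcup_(a in range s) (s @^-1` [set a] `&` s' @^-1` [set b | h a b = c]).
  apply/seteqP; split=> [t /= hc|t [a _ [/= -> ->]]] //.
  by exists (s t) => //; exists t.
apply: fin_bigcup_measurable => [|a _]; first exact: ss.1.
by apply: measurableI; exact: simple_fun_preimage.
Qed.

(** Applying [h] to the approximants gives simple functions, which converge by sequential continuity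
    of [h]. Sums, differences, operators and scalar multiples are instances. *)
Lemma strongly_measurable_comp2 Z1 Z2 Z3 (h : Z1 -> Z2 -> Z3)
    (f : Omega -> Z1) (g : Omega -> Z2) :
  (forall (u : nat -> Z1) (v : nat -> Z2) a b, u @ \oo --> a -> v @ \oo --> b ->
    (fun k => h (u k) (v k)) @ \oo --> h a b) ->
  strongly_measurable f -> strongly_measurable g ->
  strongly_measurable (fun t => h (f t) (g t)).
Proof.
move=> hc [s [ss sf]] [s' [ss' sg]]; exists (fun k t => h (s k t) (s' k t)).
split=> [k|t]; last by apply: hc; [exact: sf|exact: sg].
exact: (simple_fun_comp2 h (ss k) (ss' k)).
Qed.

Lemma strongly_measurableD Z (f g : Omega -> Z) :
  strongly_measurable f -> strongly_measurable g ->
  strongly_measurable (fun t => f t + g t).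
Proof.
move=> fm gm; apply: (strongly_measurable_comp2 (h := fun a b => a + b) _ fm gm).
by move=> u v a b; exact: cvgD.
Qed.

Lemma strongly_measurableB Z (f g : Omega -> Z) :
  strongly_measurable f -> strongly_measurable g ->
  strongly_measurable (fun t => f t - g t).
Proof.
move=> fm gm; apply: (strongly_measurable_comp2 (h := fun a b => a - b) _ fm gm).
by move=> u v a b; exact: cvgB.
Qed.

Lemma strongly_measurable_op Z1 Z2 (T : bounded_op Z1 Z2) (f : Omega -> Z1) :
  strongly_measurable f -> strongly_measurable (fun t => T (f t)).
Proof.
move=> fm; apply: (strongly_measurable_comp2 (h := fun a _ => T a) _ fm fm).
move=> u v a b ua _; apply: continuous_cvg => //; exact: bounded_op_continuous.
Qed.

Lemma strongly_measurable_cst Z (z : Z) :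
  strongly_measurable (fun _ : Omega => z).
Proof.
exists (fun _ _ => z); split=> [_|t]; last exact: cvg_cst.
split=> [|w]; first by apply: sub_finite_set (finite_set1 z) => _ [t _ <-].
by rewrite preimage_cst; case: ifP => _; [exact: measurableT|exact: measurable0].
Qed.

(** A measurable real function is a pointwise limit of simple ones, hence strongly measurable; the
    product with the constant [z] is then jointly continuous. *)
Lemma strongly_measurableZ Z (h : Omega -> R) (z : Z) :
  measurable_fun [set: Omega] h -> strongly_measurable (fun t => h t *: z).
Proof.
move=> mh.
have mEh : measurable_fun [set: Omega] (EFin \o h) by exact/measurable_EFinP.
have [s sh] := approximation_sfun measurableT mEh.
have sm : strongly_measurable (h : Omega -> R^o).
  exists (fun k t => s k t); split=> [k|t].
    by split=> // a; exact: measurable_funPTI.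
  by have := sh t I => /fine_cvgP [_].
apply: (strongly_measurable_comp2 (h := fun (a : R^o) w => a *: w) _ sm
  (strongly_measurable_cst z)).
by move=> u v a b ua vb; exact: cvgZ.
Qed.

Lemma strongly_measurable_norm Z (f : Omega -> Z) :
  strongly_measurable f -> measurable_fun [set: Omega] (fun t => `|f t|).
Proof.
move=> [s [ss sf]].
apply: (@measurable_fun_cvg _ _ _ _ (fun k t => `|s k t|)) => [k|t _].
  move=> mT Y mY; rewrite setTI.
  exact: (simple_fun_preimage _ (simple_fun_comp2 (fun a _ => `|a|) (ss k) (ss k))).
exact: cvg_norm (sf t).
Qed.

Lemma strongly_measurable_sqr_norm Z (f : Omega -> Z) :
  strongly_measurable f ->
  measurable_fun [set: Omega] (fun t => (`|f t| ^+ 2)%:E).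
Proof.
move=> /strongly_measurable_norm mf.
by apply/measurable_EFinP; exact: measurable_funX.
Qed.

Variable mu : probability Omega R.

(** A contraction does not increase the distance to the limit, so the integrals are squeezed. *)
Lemma is_L2_limit_op Z1 Z2 (T : bounded_op Z1 Z2) (u : nat -> Omega -> Z1)
    (f : Omega -> Z1) : `|T| <= 1 -> (forall N, strongly_measurable (u N)) ->
  is_L2_limit mu u f ->
  is_L2_limit mu (fun N t => T (u N t)) (fun t => T (f t)).
Proof.
move=> T1 um [fm uf]; split; first exact: strongly_measurable_op.
apply: (squeeze_cvge _ (cvg_cst 0%E : (fun=> 0%E) @ \oo --> 0%E) uf); apply: nearW => N.
apply/andP; split; first by apply: integral_ge0 => t _; rewrite lee_fin sqr_ge0.
apply: ge0_le_integral => //.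
- apply: strongly_measurable_sqr_norm; apply: strongly_measurableB.
    exact: strongly_measurable_op.
  by apply: strongly_measurable_op; exact: um.
- by apply: strongly_measurable_sqr_norm; exact: strongly_measurableB.
move=> t _; rewrite lee_fin ler_sqr ?nnegrE//.
rewrite -linearB; apply: le_trans (op_normP T _) _.
by rewrite ler_piMl.
Qed.

(** Integrating [|f1 - f2|^2 <= 2 |f1 - u N|^2 + 2 |f2 - u N|^2] and letting [N] grow gives
    [f1 = f2] almost everywhere. Hence any L2 limit computes the l-norm. *)
Lemma is_L2_limit_unique Z (u : nat -> Omega -> Z) (f1 f2 : Omega -> Z) :
  (forall N, strongly_measurable (u N)) ->
  is_L2_limit mu u f1 -> is_L2_limit mu u f2 ->
  (\int[mu]_t (`|f1 t| ^+ 2)%:E = \int[mu]_t (`|f2 t| ^+ 2)%:E)%E.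
Proof.
move=> um [m1 c1] [m2 c2].
have mD (f g : Omega -> Z) := fun mf mg =>
  strongly_measurable_sqr_norm (@strongly_measurableB Z f g mf mg).
have I0 : (\int[mu]_t (`|f1 t - f2 t| ^+ 2)%:E = 0)%E.
  apply/eqP; rewrite eq_le integral_ge0 ?andbT; last first.
    by move=> t _; rewrite lee_fin sqr_ge0.
  have fin2 : (2%:E : \bar R) \is a fin_num by [].
  have := cvgeD _ (cvgeZl fin2 c1) (cvgeZl fin2 c2).
  rewrite !mule0 adde0 => /(_ _ isT) c12.
  apply: (cvge_ge _ c12); apply: nearW => N.
  rewrite -!ge0_integralZl//; [|exact: mD..].
  rewrite -ge0_integralD//; [|by apply: measurable_funeM; exact: mD..].
  apply: ge0_le_integral => //.
  - exact: mD.
  - apply: emeasurable_funD; apply: measurable_funeM; exact: mD.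
  move=> t _; rewrite -!EFinM -EFinD lee_fin.
  have := ler_distD (u N t) (f1 t) (f2 t); rewrite (distrC (u N t)).
  set a := `|f1 t - u N t|; set b := `|f2 t - u N t|; set c := `|_| => cab.
  apply: (@le_trans _ _ ((a + b) ^+ 2)).
    by rewrite ler_sqr ?nnegrE// ?addr_ge0 ?normr_ge0.
  rewrite -subr_ge0.
  have -> : 2 * a ^+ 2 + 2 * b ^+ 2 - (a + b) ^+ 2 = (a - b) ^+ 2 by ring.
  exact: sqr_ge0.
apply: ge0_ae_eq_integral => //.
- exact: strongly_measurable_sqr_norm.
- exact: strongly_measurable_sqr_norm.
have /ae_eq_integral_abs :
    measurable_fun [set: Omega] (fun t => (`|f1 t - f2 t| ^+ 2)%:E).
  exact: mD.
move=> /(_ mu measurableT) [H _].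
have : ae_eq mu setT (fun t => (`|f1 t - f2 t| ^+ 2)%:E) (cst 0%E).
  apply: H; rewrite -[RHS]I0; apply: eq_integral => t _.
  by rewrite gee0_abs// lee_fin sqr_ge0.
apply: filterS => t /(_ I)[] /eqP; rewrite sqrf_eq0 normr_eq0 subr_eq0 => /eqP ->.
by [].
Qed.

End strong_measurability.

(** * The l-norm and the coordinates of the Gaussian sum *)

Section ell_norm.
Context {R : realType} {d : measure_display} {Omega : measurableType d}.
Context (mu : probability Omega R) (g : nat -> {RV mu >-> R}).

(** Turns bounds on [ell_norm] into bounds on the integral; at [+oo] both sides are false. *)
Lemma poweR_half_le (x : \bar R) (c : R) : (0 <= x)%E -> 0 <= c ->
  (x `^ 2^-1 <= c%:E)%E = (x <= (c ^+ 2)%:E)%E.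
Proof.
case: x => [r| |] //; last first.
  by move=> _ _; rewrite poweRyr ?invr_neq0// !leye_eq.
rewrite lee_fin => r0 c0; rewrite poweR_EFin powR12_sqrt// !lee_fin.
by rewrite -[LHS]ler_sqr ?nnegrE ?sqrtr_ge0// sqr_sqrtr.
Qed.

Lemma strongly_measurable_gaussian_partial_sum (Z : normedModType R)
    (T : bounded_op (ell2 R) Z) N :
  strongly_measurable (gaussian_partial_sum g T N).
Proof.
elim: N => [|N IHN].
  have -> : gaussian_partial_sum g T 0 = fun=> 0.
    by apply/funext => t; rewrite /gaussian_partial_sum big_ord0.
  exact: strongly_measurable_cst.
have -> : gaussian_partial_sum g T N.+1 =
    fun t => gaussian_partial_sum g T N t + g N t *: T (ell2_unit N).
  by apply/funext => t; rewrite /gaussian_partial_sum big_ord_recr.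
by apply: strongly_measurableD => //; apply: strongly_measurableZ.
Qed.

Lemma gaussian_partial_sum_comp_op (Z1 Z2 : normedModType R)
    (S : bounded_op Z1 Z2) (T : bounded_op (ell2 R) Z1) N t :
  gaussian_partial_sum g (comp_op S T) N t = S (gaussian_partial_sum g T N t).
Proof.
by rewrite /gaussian_partial_sum linear_sum; apply: eq_bigr => n _; rewrite linearZ.
Qed.

Variable X : nat -> completeNormedModType R.

Lemma ell2_proj_norm_le1 n : `|ell2_proj X n| <= 1.
Proof.
by apply: op_norm_le => x; apply: le_trans; exact: ell2_coord_le.
Qed.

(** Monotone convergence, the squared norm being the series of the squared coordinate norms. *)
Lemma integral_ell2_sum (f : Omega -> ell2_sum X) : strongly_measurable f ->
  (\int[mu]_t (`|f t| ^+ 2)%:E =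
   \sum_(0 <= n <oo) \int[mu]_t (`|f t n| ^+ 2)%:E)%E.
Proof.
move=> mf; rewrite -integral_nneseries//; last first.
  move=> n; apply: strongly_measurable_sqr_norm.
  exact: (strongly_measurable_op (ell2_proj X n)).
apply: eq_integral => t _.
rewrite [`|f t|]ell2_normE /ell2_norm sqr_sqrtr ?ell2_limn_ge0//.
rewrite -EFin_lim; last exact: ell2_coordP.
congr (lim (_ @ \oo)); apply/funext => N.
by rewrite /series /= sumEFin.
Qed.

(** Projections are contractions commuting with the partial sums, so [f t n] is an L2 limit for the
    component; the one selected by [xget] has the same integral by uniqueness. *)
Lemma integral_gaussian_sum_proj (T : bounded_op (ell2 R) (ell2_sum X))
    (f : Omega -> ell2_sum X) n :
  is_L2_limit mu (gaussian_partial_sum g T) f ->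
  (\int[mu]_t (`|gaussian_sum g (comp_op (ell2_proj X n) T) t| ^+ 2)%:E =
   \int[mu]_t (`|f t n| ^+ 2)%:E)%E.
Proof.
move=> fT.
have fn : is_L2_limit mu (gaussian_partial_sum g (comp_op (ell2_proj X n) T))
    (fun t => f t n).
  have -> : gaussian_partial_sum g (comp_op (ell2_proj X n) T) =
      fun N t => ell2_proj X n (gaussian_partial_sum g T N t).
    by apply/funext => N; apply/funext => t; exact: gaussian_partial_sum_comp_op.
  apply: is_L2_limit_op fT; first exact: ell2_proj_norm_le1.
  exact: strongly_measurable_gaussian_partial_sum.
apply: (is_L2_limit_unique _ _ fn).
  exact: strongly_measurable_gaussian_partial_sum.
by apply: xgetPex; exists (fun t => f t n).
Qed.

End ell_norm.

Theorem theorem1p19 (R : realType)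
  (d : measure_display) (Omega : measurableType d) (mu : probability Omega R)
  (g : nat -> {RV mu >-> R}) (hg : gaussian_sequence g)
  (X : nat -> completeNormedModType R)
  (K : nat -> R) (hK : has_ubound (range K))
  (hX : forall n, GAP_with g (X n) (K n)) :
  GAP g (ell2_sum X).
Proof.
(* The maximum with 1 makes the common constant positive, so that it can be divided by. *)
have [K0 K0gt0 KK0] : exists2 k : R, 0 < k & forall n, K n <= k.
  have [k kub] := hK; exists (Num.max k 1); first by rewrite lt_max ltr01 orbT.
  by move=> n; rewrite le_max kub//; exists n.
exists K0 => T finT.
(* As [pi1] is an infimum, it suffices to treat each admissible [C]; the value [+oo] is the infimum
   of the empty set. *)
rewrite muleC -lee_pdivrMr//; apply: le_ereal_inf_tmp => _ [C [C0 TC] <-].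
rewrite lee_pdivrMr// -EFinM mulrC.
have KC0 : 0 <= K0 * C by rewrite mulr_ge0// ltW.
rewrite /ell_norm poweR_half_le//; last first.
  by apply: integral_ge0 => t _; rewrite lee_fin sqr_ge0.
(* Without a limit, [gaussian_sum] is its default value 0 and the bound is immediate. *)
have [exL2|noL2] := pselect
    (exists f, is_L2_limit mu (gaussian_partial_sum g T) f); last first.
  rewrite /gaussian_sum xgetPN => [|f fL2]; last by apply: noL2; exists f.
  by rewrite normr0 expr0n /= integral0 lee_fin sqr_ge0.
have fT : is_L2_limit mu (gaussian_partial_sum g T) (gaussian_sum g T).
  exact: xgetPex exL2.
have [c cC cpi1] := pi1_bound_ell2_sum C0 TC.
rewrite (integral_ell2_sum mu fT.1).
apply: lime_le.
  by apply: is_cvg_nneseries => n _ _; apply: integral_ge0 => t _;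
    rewrite lee_fin sqr_ge0.
apply: nearW => N.
(* Termwise, the property of [X n] bounds the l-norm of the component by [K n] times its 1-summing
   norm, hence by [K0 * c n]. *)
apply: (@le_trans _ _ (\sum_(0 <= n < N) ((K0 * c n) ^+ 2)%:E)%E).
  apply: lee_sum => n _; have [c0 pic] := cpi1 n.
  rewrite -(integral_gaussian_sum_proj _ fT) -poweR_half_le; last first.
  - by rewrite mulr_ge0// ltW.
  - by apply: integral_ge0 => t _; rewrite lee_fin sqr_ge0.
  have := hX n _ (finite_rank_comp_op (ell2_proj X n) finT).
  rewrite /ell_norm => /le_trans; apply.
  rewrite EFinM.
  apply: (@le_trans _ _ (K0%:E * pi1 (adjoint (comp_op (ell2_proj X n) T)))%E).
    by apply: lee_wpmul2r; [exact: pi1_ge0|rewrite lee_fin].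
  by apply: lee_wpmul2l => //; rewrite lee_fin ltW.
rewrite sumEFin lee_fin.
under eq_bigr do rewrite exprMn.
by rewrite -mulr_sumr exprMn ler_wpM2l ?sqr_ge0//; exact: cC.
Qed.
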